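(* Let $\Delta=(Q,\Gamma,\delta)$ be a probabilistic pushdown automaton (pPDA) with fundamental PPS $f$, and let $u \in \mathbb{R}_{\ge 0}^{Q\times\Gamma\times Q}$ satisfy $\mu f \le u$. If $M_\Delta(u)\, r + \mathbf{1} \le r$ has a solution $r \in \mathbb{R}_{\ge 1}^{Q\times\Gamma}$, then $\Delta$ is PAST. In this case, $\mathsf{ert}[pZ] \le r_{pZ}$ for all $pZ\in Q\times\Gamma$.
   Context: A pPDA $\Delta=(Q,\Gamma,\delta)$ has a finite state set $Q$, a finite stack alphabet $\Gamma$, and a finite weighted transition relation $\delta \subseteq Q\times\Gamma\times\mathbb{Q}_{\ge 0}\times Q\times\Gamma^{\le 2}$ ($\Gamma^{\le 2}$: words of length at most 2), where for each $(p,Z,q,\alpha)$ there is at most one $a$ with $(p,Z,a,q,\alpha)\in\delta$; such a transition is written $pZ \xrightarrow{a} q\alpha$. For all $pZ\in Q\times\Gamma$ one requires $\sum_{pZ\xrightarrow{a}q\alpha} a = 1$. Configurations are elements $p\gamma$ of $Q\times\Gamma^*$; each transition $pZ\xrightarrow{a}q\alpha$ and $\beta\in\Gamma^*$ yields a step $pZ\beta \to q\alpha\beta$ of probability $a$; configurations $p\varepsilon$ with empty stack have no outgoing steps. The expected runtime is $\mathsf{ert}[pZ] = \big(\sum_{k\ge 0} T^k(\mathbf{1}-\chi(F))\big)_{pZ}\in[0,\infty]$, where $T$ is the matrix of step probabilities indexed by configurations, $F=Q\times\{\varepsilon\}$ and $\chi(F)$ is the $0/1$ indicator vector of $F$; equivalently,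 the sum of the probabilities (products of step probabilities) of all finite paths (of any length $\ge 0$) starting in $pZ$ that visit only configurations with non-empty stack. $\Delta$ is PAST (positively almost-surely terminating) if $\mathsf{ert}[pZ]<\infty$ for all $pZ\in Q\times\Gamma$. The fundamental PPS $f$ of $\Delta$ is the polynomial map indexed by $Q\times\Gamma\times Q$ given by $$f_{pZq}(x)=\sum_{pZ\xrightarrow{a}q\varepsilon}a+\sum_{pZ\xrightarrow{a}rY}a\,x_{rYq}+\sum_{pZ\xrightarrow{a}rYX}a\sum_{t\in Q}x_{rYt}\,x_{tXq}.$$ As a monotone map on $[0,\infty]^{Q\times\Gamma\times Q}$ it has a least fixed point $\mu f$; it is known that $(\mu f)_{pZq}$ equals the sum $[pZ|q]$ of the probabilities of all finite paths from $pZ$ to $q\varepsilon$. For $u$ indexed by $Q\times\Gamma\times Q$, $M_\Delta(u)$ is the $(Q\times\Gamma)\times(Q\times\Gamma)$ matrix defined by $$(M_\Delta(u)\,r)_{pZ}=\sum_{pZ\xrightarrow{a}rY}a\,r_{rY}+\sum_{pZ\xrightarrow{a}rYX}a\Big(r_{rY}+\sum_{t\in Q}u_{rYt}\,r_{tX}\Big)$$ for all vectors $r$ indexed by $Q\times\Gamma$ (in subscripts $r$ also denotes a state). $\mathbf{1}$ is the all-ones vector. *)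

(* Defs.v *)
From HB Require Import structures.
From mathcomp Require Import all_boot all_order all_algebra.
From mathcomp Require Import boolp classical_sets reals ereal esum sequences.

Set Implicit Arguments.
Unset Strict Implicit.
Unset Printing Implicit Defensive.

Import Order.TTheory GRing.Theory Num.Theory.

Local Open Scope classical_set_scope.
Local Open Scope ring_scope.

(* The relation delta, functional in its weight component, is represented as
   a partial function: [delta p Z q w = Some a] iff (p, Z, a, q, w) is a
   transition.  The type [2.-bseq G] consists of the words over G of length
   at most 2. *)
Record pPDA (Q G : finType) := PPDA {
  delta : Q -> G -> Q -> 2.-bseq G -> option rat;
  delta_ge0 : forall p Z q w a, delta p Z q w = Some a -> 0 <= a;
  delta_sum1 : forall p Z,
    \sum_(q : Q) \sum_(w : 2.-bseq G) odflt 0 (delta p Z q w) = 1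
}.

Definition word0 (G : finType) : 2.-bseq G :=
  @Bseq 2 G [::] isT.
Definition word1 (G : finType) (Y : G) : 2.-bseq G :=
  @Bseq 2 G [:: Y] isT.
Definition word2 (G : finType) (Y X : G) : 2.-bseq G :=
  @Bseq 2 G [:: Y; X] isT.

(* Absent transitions have weight 0, so a sum over the transitions of a given
   shape becomes a sum over all targets. *)
Definition prob (R : realType) (Q G : finType) (D : pPDA Q G)
    (p : Q) (Z : G) (q : Q) (w : 2.-bseq G) : R :=
  ratr (odflt 0 (delta D p Z q w)).

(* At most one w contributes to the sum, since w ++ beta determines w. *)
Definition step_prob (R : realType) (Q G : finType) (D : pPDA Q G)
    (c c' : Q * seq G) : R :=
  if c.2 is Z :: beta then
    \sum_(w : 2.-bseq G | c'.2 == w ++ beta) prob R D c.1 Z c'.1 w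
  else 0.

Definition step_mul (R : realType) (Q G : finType) (D : pPDA Q G)
    (v : Q * seq G -> \bar R) (c : Q * seq G) : \bar R :=
  (\esum_(c' in [set: Q * seq G]) ((step_prob R D c c')%:E * v c'))%E.

(* The vector 1 - chi(F), where F is the set of empty-stack configurations. *)
Definition nonempty_stack (R : realType) (Q G : finType)
    (c : Q * seq G) : \bar R :=
  if c.2 == [::] then 0%E else 1%E.

Definition ert (R : realType) (Q G : finType) (D : pPDA Q G)
    (p : Q) (Z : G) : \bar R :=
  (\sum_(0 <= k <oo)
     iter k (step_mul D) (@nonempty_stack R Q G) (p, [:: Z]))%E.

Definition PAST (R : realType) (Q G : finType) (D : pPDA Q G) : Prop :=
  forall p Z, (ert R D p Z < +oo)%E.

(* On \bar R the convention is 0 * +oo = 0. *)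
Definition fundamental_PPS (R : realType) (Q G : finType) (D : pPDA Q G)
    (x : Q -> G -> Q -> \bar R) (p : Q) (Z : G) (q : Q) : \bar R :=
  ((prob R D p Z q (word0 G))%:E
   + \sum_(r : Q) \sum_(Y : G) (prob R D p Z r (word1 Y))%:E * x r Y q
   + \sum_(r : Q) \sum_(Y : G) \sum_(X : G)
       (prob R D p Z r (word2 Y X))%:E * \sum_(t : Q) x r Y t * x t X q)%E.

(* m is the least fixed point of f on [0, +oo]^(Q * G * Q). *)
Definition is_lfp (R : realType) (Q G : finType)
    (f : (Q -> G -> Q -> \bar R) -> Q -> G -> Q -> \bar R)
    (m : Q -> G -> Q -> \bar R) : Prop :=
  [/\ forall p Z q, (0 <= m p Z q)%E,
      f m = m
    & forall x, (forall p Z q, (0 <= x p Z q)%E) -> f x = x ->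
        forall p Z q, (m p Z q <= x p Z q)%E].

(* [xget] selects an element of the given set, if any; see [lfp_PPSP]. *)
Definition lfp_PPS (R : realType) (Q G : finType) (D : pPDA Q G) :
    Q -> G -> Q -> \bar R :=
  xget (fun _ _ _ => 0%E) [set m | is_lfp (@fundamental_PPS R Q G D) m].

(* The product of the matrix M_D(u) with the vector s. *)
Definition M_mul (R : realType) (Q G : finType) (D : pPDA Q G)
    (u : Q -> G -> Q -> R) (s : Q -> G -> R) (p : Q) (Z : G) : R :=
  \sum_(r : Q) \sum_(Y : G) prob R D p Z r (word1 Y) * s r Y
  + \sum_(r : Q) \sum_(Y : G) \sum_(X : G)
      prob R D p Z r (word2 Y X)
      * (s r Y + \sum_(t : Q) u r Y t * s t X).

Lemma prob_ge0 (R : realType) (Q G : finType) (D : pPDA Q G) p Z q w :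
  0 <= prob R D p Z q w.
Proof.
rewrite /prob ler0q; case E : (delta D p Z q w) => [a|] //=.
exact: delta_ge0 E.
Qed.

Lemma fundamental_PPS_ge0 (R : realType) (Q G : finType) (D : pPDA Q G)
    (x : Q -> G -> Q -> \bar R) :
  (forall p Z q, 0 <= x p Z q)%E ->
  forall p Z q, (0 <= fundamental_PPS D x p Z q)%E.
Proof.
move=> x0 p Z q; rewrite /fundamental_PPS.
apply: adde_ge0; [apply: adde_ge0|].
- by rewrite lee_fin prob_ge0.
- do 2 (apply: sume_ge0 => ? _).
  by apply: mule_ge0; rewrite ?lee_fin ?prob_ge0.
- do 3 (apply: sume_ge0 => ? _).
  apply: mule_ge0; first by rewrite lee_fin prob_ge0.
  by apply: sume_ge0 => ? _; apply: mule_ge0.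
Qed.

Lemma fundamental_PPS_mono (R : realType) (Q G : finType) (D : pPDA Q G)
    (x y : Q -> G -> Q -> \bar R) :
  (forall p Z q, 0 <= x p Z q)%E ->
  (forall p Z q, x p Z q <= y p Z q)%E ->
  forall p Z q, (fundamental_PPS D x p Z q <= fundamental_PPS D y p Z q)%E.
Proof.
move=> x0 xy p Z q; rewrite /fundamental_PPS.
apply: leeD; [apply: leeD => //|].
- do 2 (apply: lee_sum => ? _).
  by apply: lee_wpmul2l; rewrite ?lee_fin ?prob_ge0.
- do 3 (apply: lee_sum => ? _).
  apply: lee_wpmul2l; first by rewrite lee_fin prob_ge0.
  by apply: lee_sum => ? _; apply: lee_pmul.
Qed.

Lemma lfp_PPSP (R : realType) (Q G : finType) (D : pPDA Q G) :
  is_lfp (@fundamental_PPS R Q G D) (lfp_PPS R D).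
Proof.
set f := @fundamental_PPS R Q G D.
pose A := [set x : Q -> G -> Q -> \bar R |
  (forall p Z q, 0 <= x p Z q)%E /\ (forall p Z q, f x p Z q <= x p Z q)%E].
pose m p Z q := ereal_inf [set x p Z q | x in A].
have m0 p Z q : (0 <= m p Z q)%E.
  by apply: le_ereal_inf_tmp => _ [x [x0 _] <-].
have mle x : A x -> forall p Z q, (m p Z q <= x p Z q)%E.
  by move=> Ax p Z q; apply: ereal_inf_lbound; exists x.
have fm p Z q : (f m p Z q <= m p Z q)%E.
  apply: le_ereal_inf_tmp => _ [x Ax <-].
  apply: le_trans (Ax.2 p Z q).
  by apply: fundamental_PPS_mono => // *; apply: mle.
have mE : f m = m.
  apply/funext => p; apply/funext => Z; apply/funext => q.
  apply/eqP; rewrite eq_le fm /=; apply: mle.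
  split=> [|p' Z' q']; first exact: fundamental_PPS_ge0.
  by apply: fundamental_PPS_mono => //; exact: fundamental_PPS_ge0.
have : [set m | is_lfp f m] m.
  by split => // x x0 xE; apply: mle; split => // *; rewrite xE.
by move=> /(xgetI (fun _ _ _ => 0%E)).
Qed.

(* Main.v *)
(** The least fixed point [m] of the fundamental PPS extends [r] to a potential
    on all configurations: a configuration [p Z beta] gets [r p Z] plus the
    [m p Z t]-weighted sum of the potentials of [t beta].  The fixed point
    equation together with [M_D(m) r + 1 <= M_D(u) r + 1 <= r] says exactly that
    one step decreases the expected potential by at least 1 as long as the
    stack is non-empty, so by induction the potential dominates every partial
    sum of the series defining the expected runtime. *)
Require Import Defs.
From HB Require Import structures.
From mathcomp Require Import all_boot all_order all_algebra.
From mathcomp Require Import boolp classical_sets reals ereal esum sequences.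
From mathcomp Require Import filter ereal_normedtype.

Import Order.TTheory GRing.Theory Num.Theory.
Local Open Scope ring_scope.

(** Separates transitions by the three shapes of target word that the fundamental PPS and [M_mul]
    treat apart: the empty word, the single letters and the pairs list the whole type without
    repetition. *)
Lemma big_bseq2 {R : Type} {idx : R} {op : Monoid.com_law idx} {G : finType}
    (F : 2.-bseq G -> R) :
  \big[op/idx]_(w : 2.-bseq G) F w =
  op (op (F (word0 G)) (\big[op/idx]_(Y : G) F (word1 Y)))
     (\big[op/idx]_(Y : G) \big[op/idx]_(X : G) F (word2 Y X)).
Proof.
pose s := word0 G :: [seq word1 Y | Y <- index_enum G] ++
  [seq word2 Y X | Y <- index_enum G, X <- index_enum G].
have sP : perm_eq (index_enum (2.-bseq G)) s.
  apply: uniq_perm; first exact: index_enum_uniq.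
    rewrite /s /= mem_cat cat_uniq; apply/and4P; split.
    - rewrite negb_or; apply/andP; split.
        by apply/mapP => -[Y _ /(congr1 val)].
      by apply/allpairsP => -[[Y X] [_ _ /(congr1 val)]].
    - by rewrite map_inj_uniq ?index_enum_uniq// => Y Y' /(congr1 val)[].
    - apply/hasPn => _ /allpairsP[[Y X] [_ _ ->]].
      by apply/mapP => -[Y' _ /(congr1 val)].
    - apply: allpairs_uniq; rewrite ?index_enum_uniq//.
      by move=> [Y X] [Y' X'] _ _ /(congr1 val)[-> ->].
  move=> w; rewrite mem_index_enum; apply/esym.
  case: w => -[|Y [|X [|A w]]] // ws; rewrite inE mem_cat.
  - apply/orP; right; apply/orP; left; apply/mapP.
    by exists Y; rewrite ?mem_index_enum//; apply: val_inj.
  - apply/orP; right; apply/orP; right; apply/allpairsP.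
    by exists (Y, X); rewrite !mem_index_enum; split => //; apply: val_inj.
rewrite (perm_big _ sP) big_cons big_cat /= big_map big_allpairs_dep.
by rewrite Monoid.mulmA.
Qed.

Section expected_runtime.
Context {R : realType} {Q G : finType} (D : pPDA Q G).
Local Open Scope ereal_scope.
Implicit Types (v : Q * seq G -> \bar R) (c : Q * seq G).

Lemma step_prob_ge0 c c' : (0 <= step_prob R D c c')%R.
Proof.
rewrite /step_prob; case: c.2 => // Z beta.
by apply: sumr_ge0 => w _; exact: prob_ge0.
Qed.

Lemma step_mul_ge0 v : (forall c, 0 <= v c) -> forall c, 0 <= step_mul D v c.
Proof.
move=> v0 c; apply: esum_ge0 => c' _.
by rewrite mule_ge0 ?lee_fin ?step_prob_ge0.
Qed.

Lemma step_mul_mono v v' : (forall c, v c <= v' c) ->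
  forall c, step_mul D v c <= step_mul D v' c.
Proof.
move=> vv' c; apply: le_esum => c' _.
by rewrite lee_wpmul2l ?lee_fin ?step_prob_ge0.
Qed.

Lemma step_mul_sum (v : nat -> Q * seq G -> \bar R) n :
  (forall k c, 0 <= v k c) ->
  forall c, step_mul D (fun c' => \sum_(0 <= k < n) v k c') c =
            \sum_(0 <= k < n) step_mul D (v k) c.
Proof.
move=> v0 c; rewrite /step_mul -esum_sum => [|c' k _ _].
  by apply: eq_esum => c' _; rewrite ge0_sume_distrr.
by rewrite mule_ge0 ?lee_fin ?step_prob_ge0.
Qed.

Lemma step_mul_nil v p : step_mul D v (p, [::]) = 0.
Proof. by apply: esum1 => c' _; rewrite /step_prob /= mul0e. Qed.

(** Each target state and word leads to exactly one configuration, so the sum over infinitely many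
    configurations reduces to a finite one over transitions. *)
Lemma step_mul_cons v p Z beta : (forall c, 0 <= v c) ->
  step_mul D v (p, Z :: beta) =
  \sum_(q : Q) \sum_(w : 2.-bseq G) (prob R D p Z q w)%:E * v (q, w ++ beta).
Proof.
move=> v0; rewrite /step_mul.
(* [F] puts the weight of a transition at its only successor; by nonnegativity the sums commute, and
   each inner one is then supported at one point. *)
pose F c' q (w : 2.-bseq G) := if c' == (q, bseqval w ++ beta)
  then (prob R D p Z q w)%:E * v c' else 0.
have F0 c' q w : 0 <= F c' q w.
  by rewrite /F; case: ifP => // _; rewrite mule_ge0 ?lee_fin ?prob_ge0.
transitivity (\esum_(c' in [set: Q * seq G]) \sum_(q : Q) \sum_w F c' q w).
  apply: eq_esum => -[q g] _; rewrite (bigD1 q)//= [X in _ + X]big1 ?adde0.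
    rewrite /step_prob /= -sumEFin ge0_sume_distrl; last first.
      by move=> w _; rewrite lee_fin prob_ge0.
    by rewrite big_mkcond; apply: eq_bigr => w _; rewrite /F xpair_eqE eqxx.
  move=> q' q'q; apply: big1 => w _.
  by rewrite /F xpair_eqE eq_sym (negbTE q'q).
rewrite esum_sum; last by move=> *; exact: sume_ge0.
apply: eq_bigr => q _; rewrite esum_sum//; apply: eq_bigr => w _.
rewrite -(@esum_set1 _ _ (q, bseqval w ++ beta)
  (fun c' => (prob R D p Z q w)%:E * v c')).
  rewrite [RHS]esum_mkcond; apply: eq_esum => c' _.
  by rewrite /F in_set1.
by rewrite mule_ge0 ?lee_fin ?prob_ge0.
Qed.

Lemma nonempty_stack_ge0 c : 0 <= nonempty_stack R c.
Proof. by rewrite /nonempty_stack; case: ifP. Qed.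

Lemma iter_step_mul_ge0 k c :
  0 <= iter k (step_mul D) (@nonempty_stack R Q G) c.
Proof.
elim: k c => [|k IH] c; first exact: nonempty_stack_ge0.
exact: step_mul_ge0.
Qed.

(** The first n + 1 terms of the series add up to the indicator of non-empty stacks plus one step
    applied to the sum of the first n terms, so the bound by [v] propagates. *)
Lemma ert_le_potential v : (forall c, 0 <= v c) ->
  (forall c, nonempty_stack R c + step_mul D v c <= v c) ->
  forall p Z, ert R D p Z <= v (p, [:: Z]).
Proof.
move=> v0 vP p Z; apply: lime_le.
  by apply: is_cvg_nneseries => n _ _; exact: iter_step_mul_ge0.
(* The induction must range over all configurations, since a step can change the stack height. *)
apply: nearW => n; move: (p, [:: Z]) => c {p Z}.
elim: n c => [|n IH] c; first by rewrite big_geq.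
rewrite big_nat_recl//=; apply: le_trans (vP c); apply: leeD => //.
rewrite -step_mul_sum; last exact: iter_step_mul_ge0.
exact: step_mul_mono.
Qed.

End expected_runtime.

Section potential.
Context {R : realType} {Q G : finType} (D : pPDA Q G).
Variables (m : Q -> G -> Q -> R) (r : Q -> G -> R).

Fixpoint potential (s : seq G) (p : Q) : R :=
  if s is Z :: beta then r p Z + \sum_(t : Q) m p Z t * potential beta t else 0.

Lemma potential_ge0 :
  (forall p Z q, 0 <= m p Z q) -> (forall p Z, 0 <= r p Z) ->
  forall s p, 0 <= potential s p.
Proof.
move=> m0 r0; elim=> [|Z s IH] p //=.
by rewrite addr_ge0// sumr_ge0// => t _; rewrite mulr_ge0.
Qed.

Lemma fundamental_PPS_EFin p Z q :
  (fundamental_PPS D (fun p Z q => (m p Z q)%:E) p Z q =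
  (prob R D p Z q (word0 G)
   + \sum_(s : Q) \sum_(Y : G) prob R D p Z s (word1 Y) * m s Y q
   + \sum_(s : Q) \sum_(Y : G) \sum_(X : G)
       prob R D p Z s (word2 Y X) * \sum_(t : Q) m s Y t * m t X q)%:E)%E.
Proof.
rewrite /fundamental_PPS !EFinD -!sumEFin; congr (_ + _ + _)%E.
  by apply: eq_bigr => s _; rewrite -sumEFin.
apply: eq_bigr => s _; rewrite -sumEFin; apply: eq_bigr => Y _.
rewrite -sumEFin; apply: eq_bigr => X _.
by rewrite [RHS]EFinM -sumEFin.
Qed.

Lemma sum_step_potential p Z beta :
  (forall q, fundamental_PPS D (fun p Z q => (m p Z q)%:E) p Z q
             = (m p Z q)%:E) ->
  \sum_(q : Q) \sum_(w : 2.-bseq G) prob R D p Z q w * potential (w ++ beta) q =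
  M_mul D m r p Z + \sum_(t : Q) m p Z t * potential beta t.
Proof.
move=> fm.
have {fm}mE q :=
  esym (EFin_inj (etrans (esym (fundamental_PPS_EFin p Z q)) (fm q))).
(* Only the factors for the top symbol [Z] are unfolded by the fixed point equation. *)
under [in RHS]eq_bigr => t _ do rewrite mE !mulrDl.
under [LHS]eq_bigr => q _ do rewrite big_bseq2 /=.
rewrite !big_split /= /M_mul.
(* Match by word length: the pop terms agree at once, and for lengths 1 and 2 the term of [M_mul]
   joins that of the fixed point equation. *)
rewrite [RHS]addrACA [X in _ = X + _]addrCA; congr (_ + _ + _).
  under [X in _ = _ + X]eq_bigr => t _ do rewrite mulr_suml.
  rewrite [X in _ = _ + X]exchange_big -big_split; apply: eq_bigr => q _ /=.
  under [X in _ = _ + X]eq_bigr => t _ do rewrite mulr_suml.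
  rewrite [X in _ = _ + X]exchange_big -big_split; apply: eq_bigr => Y _ /=.
  rewrite mulrDr mulr_sumr; congr (_ + _).
  by apply: eq_bigr => t _; rewrite mulrA.
under [X in _ = _ + X]eq_bigr => t _ do rewrite mulr_suml.
rewrite [X in _ = _ + X]exchange_big -big_split; apply: eq_bigr => q _ /=.
under [X in _ = _ + X]eq_bigr => t _ do rewrite mulr_suml.
rewrite [X in _ = _ + X]exchange_big -big_split; apply: eq_bigr => Y _ /=.
under [X in _ = _ + X]eq_bigr => t _ do rewrite mulr_suml.
rewrite [X in _ = _ + X]exchange_big -big_split; apply: eq_bigr => X _ /=.
under [X in _ = _ + X]eq_bigr => t _ do rewrite -mulrA.
rewrite -mulr_sumr -mulrDr -addrA; congr (_ * (_ + _)).
(* For a push of [Y] and [X], swap the state reached after removing [Y] with the one reached after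
   removing [X]. *)
under [X in _ = _ + X]eq_bigr => t _ do rewrite mulr_suml.
rewrite [X in _ = _ + X]exchange_big -big_split; apply: eq_bigr => t _ /=.
rewrite mulrDr mulr_sumr; congr (_ + _).
by apply: eq_bigr => t' _; rewrite mulrA.
Qed.

End potential.

(** Transfers the inequality assumed for [u] to the least fixed point, for which the potential
    identity holds exactly. *)
Lemma M_mul_mono (R : realType) (Q G : finType) (D : pPDA Q G)
    (m u : Q -> G -> Q -> R) (s : Q -> G -> R) :
  (forall p Z, 0 <= s p Z) -> (forall p Z q, m p Z q <= u p Z q) ->
  forall p Z, M_mul D m s p Z <= M_mul D u s p Z.
Proof.
move=> s0 mu p Z; apply: lerD => //.
do 3 (apply: ler_sum => ? _).
apply: ler_wpM2l; first exact: prob_ge0.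
by apply: lerD => //; apply: ler_sum => t _; apply: ler_wpM2r.
Qed.

Theorem corollary1 (R : realType) (Q G : finType) (D : pPDA Q G)
    (u : Q -> G -> Q -> R)
    (u_ge0 : forall p Z q, 0 <= u p Z q)
    (lfp_le_u : forall p Z q, (lfp_PPS R D p Z q <= (u p Z q)%:E)%E)
    (r : Q -> G -> R)
    (r_ge1 : forall p Z, 1 <= r p Z)
    (r_sol : forall p Z, M_mul D u r p Z + 1 <= r p Z) :
  PAST R D /\ forall p Z, (ert R D p Z <= (r p Z)%:E)%E.
Proof.
suff ert_le p Z : (ert R D p Z <= (r p Z)%:E)%E.
  by split => // p Z; exact: le_lt_trans (ert_le p Z) (ltry _).
have [lfp0 lfpE _] := @lfp_PPSP R Q G D.
pose m p Z q := fine (lfp_PPS R D p Z q).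
(* The real bound [u] makes the least fixed point finite, so [fine] loses nothing. *)
have mE p' Z' q : (m p' Z' q)%:E = lfp_PPS R D p' Z' q.
  rewrite fineK// ge0_fin_numE//.
  exact: le_lt_trans (lfp_le_u _ _ _) (ltry _).
have m0 p' Z' q : 0 <= m p' Z' q by rewrite -lee_fin mE.
have mu p' Z' q : m p' Z' q <= u p' Z' q by rewrite -lee_fin mE.
have r0 p' Z' : 0 <= r p' Z' by exact: le_trans (r_ge1 _ _).
have fm p' Z' q :
    fundamental_PPS D (fun p Z q => (m p Z q)%:E) p' Z' q = (m p' Z' q)%:E.
  have -> : (fun p Z q => (m p Z q)%:E) = lfp_PPS R D.
    by do 3 (apply/funext => ?).
  by rewrite lfpE mE.
have -> : r p Z = potential m r [:: Z] p.
  by rewrite /= big1 ?addr0// => t _; rewrite mulr0.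
have pot0 c : (0 <= (potential m r c.2 c.1)%:E)%E.
  by rewrite lee_fin potential_ge0.
apply: (@ert_le_potential _ _ _ D (fun c => (potential m r c.2 c.1)%:E)) => //.
move=> [q [|Y beta]].
  by rewrite step_mul_nil adde0.
rewrite step_mul_cons//.
under eq_bigr => q' _.
  under eq_bigr => w _ do rewrite -EFinM.
  rewrite sumEFin.
  over.
rewrite sumEFin /= sum_step_potential// /nonempty_stack /= -EFinD lee_fin.
(* The contribution of [beta] is the same on both sides and cancels. *)
rewrite addrA lerD2r addrC; apply: le_trans (r_sol q Y).
by rewrite lerD2r; exact: M_mul_mono.
Qed.
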